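(* Let $f_0\neq f_1$ be probability densities, and consider observations $X_1, X_2, \dots$. For a change point $\nu\in\mathbb{N}\cup\{\infty\}$, $\Pr_\nu$ denotes the law under which $X_1,\dots,X_{\nu-1}$ are i.i.d. $f_0$ and $X_\nu,X_{\nu+1},\dots$ are i.i.d. $f_1$, independent of the former. For $\delta_{\mathrm{F}}\in(0,1)$ and $r>1$, let $\zeta(r)=\sum_{i\ge1} i^{-r}$, $W_n=\max_{1\le k\le n}\sum_{i=k}^n\log\frac{f_1(X_i)}{f_0(X_i)}$, and $\tau_r=\inf\{n\in\mathbb{N}: W_n\ge \log(\zeta(r) n^r/\delta_{\mathrm{F}})\}$. For $T\in\mathbb{N}$ and $\delta_{\mathrm{D}}\in(0,1)$ define the high-probability latency $$d_r(T,\delta_{\mathrm{F}},\delta_{\mathrm{D}})=\inf\{d\in\mathbb{N}: \Pr_\nu(\tau_r\ge \nu+d)\le\delta_{\mathrm{D}}\ \text{for all } \nu\in\{1,\dots,T-d\}\}.$$ Let $\Lambda(\theta)=\log \mathbb{E}_{f_1}\left[\exp\left(\theta\log\frac{f_0(X)}{f_1(X)}\right)\right]$ for $X\sim f_1$. Then for all $T\in\mathbb{N}$, $\delta_{\mathrm{F}},\delta_{\mathrm{D}}\in(0,1)$ and $r>1$, $$d_r(T,\delta_{\mathrm{F}},\delta_{\mathrm{D}})\le \inf_{\theta\in(0,1)}\left\{\frac{1}{|\Lambda(\theta)|}\left[\log\frac{1}{\delta_{\mathrm{D}}}+\theta\log\frac{1}{\delta_{\mathrm{F}}}+r\theta\log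 T+\theta\log\zeta(r)\right]\right\}.$$
   Context: $\tau_r$ is the time-varying threshold CuSum (TVT-CuSum) stopping time; $\Lambda$ is the cumulant generating function of the log-likelihood ratio $\log(f_0(X)/f_1(X))$ under $X\sim f_1$.
   Formalization: The right-hand side is rounded up to the least positive integer at or above the infimum, since the latency is a positive integer while the infimum can lie below 1 (e.g. unit-variance normal densities with far-apart means), so the unrounded inequality fails. *)

(* Defs.v *)
From HB Require Import structures.
From mathcomp Require Import all_boot all_order all_algebra.
From mathcomp Require Import all_classical all_reals all_analysis.

Set Implicit Arguments.
Unset Strict Implicit.
Unset Printing Implicit Defensive.

Import Order.TTheory GRing.Theory Num.Theory.
Import numFieldNormedType.Exports.

Local Open Scope classical_set_scope.
Local Open Scope ring_scope.
Local Open Scope ereal_scope.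

(* Times, horizons and latencies range over the positive integers 1, 2, ... *)

Section Densities.
Context {R : realType} {dS : measure_display} {S : measurableType dS}.
Variable mu : {sigma_finite_measure set S -> \bar R}.

Definition density (f : S -> R) : Prop :=
  [/\ measurable_fun setT f, forall x, (0 <= f x)%R &
      \int[mu]_x (f x)%:E = 1].

(* log (f x / g x) in the extended reals, so that the densities may vanish:
   it is +oo if g x = 0 < f x, and -oo if f x = 0 (including f x = g x = 0,
   which has probability 0 under both densities). *)
Definition log_ratio (f g : S -> R) (x : S) : \bar R :=
  lne ((f x)%:E / (g x)%:E).

(* Since expeR +oo * 0 = 0, points with f1 x = 0 do not contribute. *)
Definition Lambda (f0 f1 : S -> R) (theta : R) : \bar R :=
  lne (\int[mu]_x (expeR (theta%:E * log_ratio f0 f1 x) * (f1 x)%:E)).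

End Densities.

Section ChangePoint.
Context {R : realType} {dS dO : measure_display}
        {S : measurableType dS} {Omega : measurableType dO}.

Definition mutually_independent (P : probability Omega R)
    (I : set nat) (X : nat -> {mfun Omega >-> S}) : Prop :=
  forall (J : seq nat) (A : nat -> set S),
    uniq J -> [set` J] `<=` I -> (forall i, measurable (A i)) ->
    P (\bigcap_(i in [set` J]) (X i @^-1` A i)) =
    \prod_(i <- J) P (X i @^-1` A i).

(* A change point is [Some nu] with 0 < nu, or [None] for nu = oo. *)
Definition change_point (nu : option nat) : bool :=
  if nu is Some k then (0 < k)%N else true.

Definition before_change (nu : option nat) (i : nat) : bool :=
  if nu is Some k then (i < k)%N else true.

(* The observations are X 1, X 2, ...; X 0 is never used. *)
Definition change_point_model (mu : {sigma_finite_measure set S -> \bar R})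
    (f0 f1 : S -> R) (Pr : option nat -> probability Omega R)
    (X : nat -> {mfun Omega >-> S}) : Prop :=
  forall nu, change_point nu ->
    mutually_independent (Pr nu) [set i | (0 < i)%N] X /\
    forall i, (0 < i)%N -> forall A : set S, measurable A ->
      Pr nu (X i @^-1` A) =
      \int[mu]_(x in A) (if before_change nu i then f0 x else f1 x)%:E.

Definition zeta (r : R) : R := limn (series (riemannR r)).

Definition cusum (f0 f1 : S -> R) (X : nat -> {mfun Omega >-> S})
    (n : nat) (w : Omega) : \bar R :=
  \big[maxe/-oo]_(1 <= k < n.+1)
    \sum_(k <= i < n.+1) log_ratio f1 f0 (X i w).

Definition threshold (r deltaF : R) (n : nat) : R :=
  ln (zeta r * n%:R `^ r / deltaF)%R.

Definition tau (f0 f1 : S -> R) (X : nat -> {mfun Omega >-> S})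
    (r deltaF : R) (w : Omega) : \bar R :=
  ereal_inf [set n%:R%:E | n in
    [set n : nat | (0 < n)%N /\
       (threshold r deltaF n)%:E <= cusum f0 f1 X n w]].

Definition latency (f0 f1 : S -> R) (Pr : option nat -> probability Omega R)
    (X : nat -> {mfun Omega >-> S}) (r : R) (T : nat) (deltaF deltaD : R) :
    \bar R :=
  ereal_inf [set d%:R%:E | d in
    [set d : nat | (0 < d)%N /\
       forall nu, (1 <= nu <= T - d)%N ->
         Pr (Some nu) [set w | (nu + d)%:R%:E <= tau f0 f1 X r deltaF w]
           <= deltaD%:E]].

End ChangePoint.

(* The least positive integer that is at least x (+oo if there is none).
   A latency is a positive integer, so a real upper bound on it (which is
   arbitrarily close to 0 when f0 and f1 are far apart) is rounded up. *)
Definition round_up {R : realType} (x : \bar R) : \bar R :=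
  ereal_inf [set n%:R%:E | n in [set n : nat | (0 < n)%N /\ x <= n%:R%:E]].

(* Main.v *)
Require Import Defs.
From HB Require Import structures.
From mathcomp Require Import all_boot all_order all_algebra.
From mathcomp Require Import all_classical all_reals all_analysis.
From mathcomp Require Import measurable_realfun ring lra.

(* If tau >= nu + d then the CuSum is below its threshold at time
   n = nu + d - 1 <= T, hence so is the log-likelihood ratio summed over the d
   post-change observations nu, ..., n. Raising the likelihood ratio f0 / f1 to
   a power theta in (0, 1), Markov's inequality and independence bound the
   probability of this event by exp (theta * threshold n + d * Lambda theta).
   This is at most deltaD as soon as d |Lambda theta| >= ln (1 / deltaD)
   + theta * threshold T; since the latter is positive and bounded in theta,
   the bound persists in the limit to the infimum over theta. *)

Set Implicit Arguments.
Unset Strict Implicit.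
Unset Printing Implicit Defensive.

Import Order.TTheory GRing.Theory Num.Theory.
Import numFieldNormedType.Exports.

Local Open Scope classical_set_scope.
Local Open Scope ring_scope.
Local Open Scope ereal_scope.

(** * Convergence of the zeta series for r > 1 *)

Section Zeta.
Context {R : realType}.
Local Open Scope ring_scope.

(** Divided by [y ^ (- a)], this reads 1 + a / y <= (1 - 1 / y) ^ (- a), which follows from 1 + x <=
    exp x and ln (1 - 1 / y) <= - 1 / y. *)
Lemma powRN_telescope (a y : R) : 0 <= a -> 1 < y ->
  a * (y `^ (1 + a))^-1 <= (y - 1) `^ (- a) - y `^ (- a).
Proof.
move=> a0 y1; have y0 : 0 < y by lra.
have iy1 : y^-1 < 1 by rewrite invf_lt1.
have iy0 : 0 < y^-1 by rewrite invr_gt0.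
have -> : y - 1 = y * (1 - y^-1) by rewrite mulrBr mulr1 divff ?gt_eqF.
rewrite powRM ?subr_ge0 ?(ltW y0) ?(ltW iy1)// -powRN opprD powRD; last first.
  by rewrite (gt_eqF y0) implybT.
rewrite powR_inv1 ?(ltW y0)// lerBrDr mulrCA -[X in _ + X]mul1r.
rewrite mulrA -mulrDl mulrC ler_wpM2l ?powR_ge0//.
rewrite /powR gt_eqF ?subr_gt0//.
apply: le_trans (expR_ge1Dx _).
have := le_ln1Dx (x := - y^-1); rewrite ltrN2 iy1 => /(_ isT) h.
rewrite addrC lerD2l mulNr -mulrN mulrC ler_wpM2l//; lra.
Qed.

(** Since [zeta] is a [limn], its value is meaningful only once convergence is known. The terms are
    positive, and telescoping bounds the partial sums by 1 + 1 / (r - 1). *)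
Lemma cvg_riemannR (r : R) : 1 < r -> cvgn (series (riemannR r)).
Proof.
move=> r1; have a0 : 0 < r - 1 by lra.
have rE : 1 + (r - 1) = r by lra.
apply: nondecreasing_is_cvgn.
  apply: nondecreasing_series => n _ _; apply/ltW/riemannR_gt0; lra.
exists (1 + (r - 1)^-1) => _ [n _ <-].
(* The subtracted power of [m.+1] is the telescoping remainder that lets the induction close. *)
have bnd m : series (riemannR r) m.+1 <=
    1 + (r - 1)^-1 * (1 - m.+1%:R `^ (- (r - 1))).
  elim: m => [|m ih].
    by rewrite seriesEnat/= big_nat1 /riemannR !powR1 invr1 subrr mulr0 addr0.
  rewrite seriesEnat/= big_nat_recr//=.
  have := powRN_telescope (ltW a0) (_ : 1 < m.+2%:R :> R).
  rewrite ltr1n rE => /(_ isT).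
  rewrite -(ler_pM2l (_ : 0 < (r - 1)^-1)) ?invr_gt0// mulKf ?gt_eqF//.
  have -> : m.+2%:R - 1 = m.+1%:R :> R by rewrite -natr1 addrK.
  rewrite mulrBr => h.
  move: ih; rewrite seriesEnat /= /riemannR !mulrBr; lra.
have C0 : 0 <= (r - 1)^-1 by rewrite invr_ge0 ltW.
case: n => [|n]; first by rewrite seriesEnat/= big_geq//; lra.
apply: le_trans (bnd n) _; rewrite lerD2l ler_piMr//.
Qed.

Lemma zeta_ge1 (r : R) : 1 < r -> 1 <= zeta r.
Proof.
move=> r1; have <- : series (riemannR r) 1 = 1.
  by rewrite seriesEnat/= big_nat1 /riemannR powR1 invr1.
apply: nondecreasing_cvgn_le; last exact: cvg_riemannR.
by apply: nondecreasing_series => n _ _; apply/ltW/riemannR_gt0; lra.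
Qed.

End Zeta.

(** * Transfer of weighted integrals from sets to functions *)

Section Independence.
Context {R : realType}.

Import HBNNSimple.

(* Both sides are the same limit of linear combinations of masses of the
   level sets of simple functions approximating g. *)
Lemma eq_integral_comp_weight d1 d2 d (T1 : measurableType d1)
    (T2 : measurableType d2) (S : measurableType d)
    (m1 : {measure set T1 -> \bar R}) (m2 : {measure set T2 -> \bar R})
    (D1 : set T1) (D2 : set T2) (X1 : T1 -> S) (X2 : T2 -> S)
    (u1 : T1 -> R) (u2 : T2 -> R) (g : S -> \bar R) :
  measurable D1 -> measurable D2 ->
  measurable_fun setT X1 -> measurable_fun setT X2 ->
  measurable_fun setT u1 -> measurable_fun setT u2 ->
  (forall x, 0 <= u1 x)%R -> (forall x, 0 <= u2 x)%R ->
  measurable_fun setT g -> (forall x, 0 <= g x) ->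
  (forall B, measurable B -> \int[m1]_(x in D1 `&` X1 @^-1` B) (u1 x)%:E =
                             \int[m2]_(x in D2 `&` X2 @^-1` B) (u2 x)%:E) ->
  \int[m1]_(x in D1) (g (X1 x) * (u1 x)%:E) = \int[m2]_(x in D2) (g (X2 x) * (u2 x)%:E).
Proof.
move=> mD1 mD2 mX1 mX2 mu1 mu2 u10 u20 mg g0 H.
pose h := nnsfun_approx measurableT mg.
(* The approximations [h] depend on [g] only, so both integrals become limits of the same expression
   in the weighted masses of preimages. *)
have lim_h (d' : measure_display) (T : measurableType d')
    (m : {measure set T -> \bar R}) (D : set T) (X : T -> S) (u : T -> R) :
    measurable D -> measurable_fun setT X -> measurable_fun setT u ->
    (forall x, 0 <= u x)%R ->
  \int[m]_(x in D) (g (X x) * (u x)%:E) = limn (fun n =>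
    (\sum_(y \in range (h n))
       y%:E * \int[m]_(x in D `&` X @^-1` (h n @^-1` [set y])) (u x)%:E)).
  move=> mD mX mu u0.
  have mhX n : measurable_fun setT (fun x => (h n (X x))%:E).
    by apply/measurable_EFinP; exact: measurableT_comp.
  have mX' B : measurable B -> measurable (X @^-1` B).
    by move=> mB; rewrite -[_ @^-1` _]setTI; exact: mX.
  transitivity (\int[m]_(x in D) limn (fun n => (h n (X x))%:E * (u x)%:E)).
    apply: eq_integral => x _; apply/esym/cvg_lim => //.
    have hX : (EFin \o h ^~ (X x)) n @[n --> \oo] --> g (X x).
      by apply: cvg_nnsfun_approx.
    exact: cvgeZr.
  rewrite monotone_convergence//; last 3 first.
  - move=> n; apply: measurable_funTS; apply: emeasurable_funM => //.
    exact/measurable_EFinP.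
  - by move=> n x _; rewrite mule_ge0// lee_fin.
  - move=> x _ a b ab; rewrite lee_wpmul2r ?lee_fin//.
    by have /lefP := nd_nnsfun_approx measurableT mg ab; exact.
  congr (limn _); apply/funext => n.
  transitivity (\int[m]_(x in D) (\sum_(y \in range (h n))
      (y%:E * ((\1_(X @^-1` (h n @^-1` [set y])) x)%:E * (u x)%:E)))).
    apply: eq_integral => x _.
    rewrite [in LHS]fimfunE -fsumEFin// ge0_mule_fsuml; last first.
      by move=> y; exact: nnfun_muleindic_ge0.
    by apply: eq_fsbigr => y _; rewrite EFinM muleA.
  rewrite ge0_integral_fsum//; last 2 first.
  - move=> y; apply: measurable_funTS; apply: measurable_funeM.
    apply: emeasurable_funM; apply/measurable_EFinP => //.
    by apply: measurable_indic; exact: mX'.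
  - move=> y x _; rewrite muleA -EFinM EFinM mule_ge0 ?lee_fin ?u0//.
    exact: nnfun_muleindic_ge0.
  (* Writing [y] as a value of [h n] shows that it is nonnegative, which allows pulling it out of
     the integral. *)
  apply: eq_fsbigr => y; rewrite inE => -[t _ <-].
  rewrite ge0_integralZl_EFin//; last 2 first.
  - by move=> x _; rewrite mule_ge0// lee_fin.
  - apply: measurable_funTS; apply: emeasurable_funM; apply/measurable_EFinP => //.
    by apply: measurable_indic; exact: mX'.
  congr (_ * _).
  rewrite integral_mkcondr; apply: eq_integral => x _.
  by rewrite epatch_indic muleC.
rewrite (lim_h _ _ m1 D1 X1 u1)// (lim_h _ _ m2 D2 X2 u2)//.
congr (limn _); apply/funext => n; apply: eq_fsbigr => y _.
by rewrite H.
Qed.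

End Independence.

(** * Expectation of a product of functions of independent observations *)

Section IndependentProducts.
Context {R : realType} {dS dO : measure_display}
        {S : measurableType dS} {Omega : measurableType dO}.

Lemma measurable_bigcap_seq (s : seq nat) (E : nat -> set Omega) :
  (forall i, measurable (E i)) -> measurable (\bigcap_(i in [set` s]) E i).
Proof. by move=> mE; apply: bigcap_measurableType => i _; exact: mE. Qed.

Lemma integral_prod_independent (mu : {measure set S -> \bar R})
    (P : probability Omega R) (I : set nat) (X : nat -> {mfun Omega >-> S})
    (f g : S -> R) :
  measurable_fun setT f -> (forall x, 0 <= f x)%R ->
  measurable_fun setT g -> (forall x, 0 <= g x)%R ->
  mutually_independent P I X ->
  (forall i, I i -> forall A, measurable A ->
     P (X i @^-1` A) = \int[mu]_(x in A) (f x)%:E) ->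
  \int[mu]_x (g x * f x)%:E \is a fin_num ->
  forall s, uniq s -> [set` s] `<=` I ->
  \int[P]_w (\prod_(i <- s) g (X i w))%:E =
  (\int[mu]_x (g x * f x)%:E) ^+ size s.
Proof.
move=> mf f0 mg g0 indep law Jfin s us sI.
have mX i : measurable_fun setT (X i) by exact: measurable_funP.
have mpre i A : measurable A -> measurable (X i @^-1` A).
  by move=> mA; rewrite -[_ @^-1` _]setTI; exact: mX.
set J := \int[mu]_x _ in Jfin *.
(* The induction on [s] needs extra events on a disjoint list [s']: each observation removed from
   the product becomes such an event. *)
suff H s' (A : nat -> set S) : uniq (s ++ s') -> [set` s ++ s'] `<=` I ->
    (forall i, measurable (A i)) ->
    \int[P]_(w in \bigcap_(i in [set` s']) (X i @^-1` A i))
      (\prod_(i <- s) g (X i w))%:E =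
    J ^+ size s * \prod_(i <- s') P (X i @^-1` A i).
  have := H [::] (fun=> setT); rewrite cats0 big_nil mule1 set_nil bigcap_set0.
  exact.
elim: s {us sI} s' A => [|a s ih] s' A.
  rewrite cat0s => us sI mA; rewrite expe0 mul1e -indep//.
  under eq_integral do rewrite big_nil.
  by rewrite integral_cst ?mul1e//; apply: measurable_bigcap_seq => i; exact/mpre/mA.
rewrite cat_cons cons_uniq => /andP[ass us] sI mA.
pose K := J ^+ size s * \prod_(i <- s') P (X i @^-1` A i).
have Kfin : K \is a fin_num.
  rewrite fin_numM//; first by rewrite fin_numX.
  by apply: prode_fin_num => i _; apply: fin_num_measure; exact: mpre.
have J0 : 0 <= J by apply: integral_ge0 => x _; rewrite lee_fin mulr_ge0.
have K0 : 0 <= K by rewrite mule_ge0 ?expe_ge0// prode_ge0.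
under eq_integral do rewrite big_cons EFinM.
(* The factor at [a] is integrated out: [X a] under [P], weighted by the other factors, is replaced
   by the identity under [mu] with weight [fine K * f x]. For sets [B] the two masses agree by the
   induction hypothesis. *)
rewrite (@eq_integral_comp_weight R _ _ _ _ _ _ P mu _ setT (X a) id
  (fun w => \prod_(i <- s) g (X i w))%R (fun x => fine K * f x)%R (EFin \o g))//.
- rewrite expeS -muleA -/K -[K in RHS]fineK// muleC.
  rewrite -ge0_integralZl_EFin//; last 3 first.
  + by move=> x _; rewrite lee_fin mulr_ge0.
  + by apply/measurable_EFinP; exact: measurable_funM.
  + exact: fine_ge0.
  by apply: eq_integral => x _ /=; rewrite -!EFinM mulrCA.
- by apply: measurable_bigcap_seq => i; exact/mpre/mA.
- apply: measurable_prod => i _; exact: measurableT_comp.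
- exact: measurable_funM.
- by move=> w; exact: prodr_ge0.
- by move=> x; rewrite mulr_ge0// fine_ge0.
- exact/measurable_EFinP.
- move=> B mB; rewrite setTI preimage_id.
  under [RHS]eq_integral do rewrite EFinM.
  rewrite ge0_integralZl_EFin ?fine_ge0//; last 2 first.
    by move=> x _; rewrite lee_fin.
    by apply: measurable_funTS; exact/measurable_EFinP.
  rewrite fineK//.
  (* The induction hypothesis is used with [a :: s'], so the event that [X a] lies in [B] joins the
     family; [a] is not in [s'], hence the other events are unchanged. *)
  pose A' i := if i == a then B else A i.
  have A'a : A' a = B by rewrite /A' eqxx.
  have A's i : i \in s' -> A' i = A i.
    rewrite /A'; case: eqP => [->|//] as'.
    by move: ass; rewrite mem_cat as' orbT.
  have := ih (a :: s') A'; rewrite big_cons A'a.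
  rewrite law//; last by apply: sI => /=; rewrite mem_head.
  rewrite (eq_big_seq (fun i => P (X i @^-1` A i))); last first.
    by move=> i is'; rewrite A's.
  rewrite muleCA -/K muleC => <-.
  + congr (integral _ _ _); apply/seteqP; split => w.
      move=> [Ew Bw] i /=; rewrite inE => /predU1P[->|is'].
        by rewrite A'a.
      by rewrite A's//; exact: Ew.
    move=> Ew; split.
      by move=> i is'; rewrite -A's//; apply: Ew; rewrite /= inE is' orbT.
    by rewrite -A'a; apply: Ew; rewrite /= mem_head.
  + by rewrite uniq_catC cat_cons cons_uniq mem_cat orbC -mem_cat ass uniq_catC.
  + move=> i /= iss; apply: sI => /=.
    by move: iss; rewrite !(mem_cat, inE) orbCA.
  + by move=> i; rewrite /A'; case: ifP.
Qed.

End IndependentProducts.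

(** * Powers of the likelihood ratio *)

Section LikelihoodRatio.
Context {R : realType} {dS : measure_display} {S : measurableType dS}.
Variables (f0 f1 : S -> R).
Hypotheses (mf0 : measurable_fun setT f0) (mf1 : measurable_fun setT f1).
Hypotheses (f0_ge0 : forall x, (0 <= f0 x)%R) (f1_ge0 : forall x, (0 <= f1 x)%R).

(** A real-valued form of (f0 / f1) ^ theta. For nonzero [theta], [powR] gives it the default value
    0 where [f1] vanishes, a set of mass zero under [f1]. *)
Definition likelihood_power (theta : R) (x : S) : R :=
  (f0 x `^ theta * f1 x `^ (- theta))%R.

Lemma likelihood_power_ge0 theta x : (0 <= likelihood_power theta x)%R.
Proof. by rewrite mulr_ge0 ?powR_ge0. Qed.

Lemma measurable_likelihood_power theta :
  measurable_fun setT (likelihood_power theta).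
Proof.
apply: measurable_funM.
  exact: (measurableT_comp (measurable_powR theta)).
exact: (measurableT_comp (measurable_powR (- theta))).
Qed.

(* Weighted AM-GM. *)
Lemma likelihood_power_le theta x : (0 < theta < 1)%R ->
  (likelihood_power theta x * f1 x <= theta * f0 x + (1 - theta) * f1 x)%R.
Proof.
move=> /andP[t0 t1]; have t1' : (0 < 1 - theta)%R by lra.
have [f1x0|f1x0] := eqVneq (f1 x) 0%R.
  by rewrite f1x0 !mulr0 addr0 mulr_ge0// ltW.
rewrite /likelihood_power -mulrA -{2}[f1 x]powRr1// -powRD ?f1x0 ?implybT//.
rewrite [(- _ + 1)%R]addrC.
(* Young's inequality with the conjugate exponents 1 / theta and 1 / (1 - theta). *)
apply: le_trans (conjugate_powR (powR_ge0 _ _) (powR_ge0 _ _)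
  (_ : 0 < theta^-1)%R (_ : 0 < (1 - theta)^-1)%R _) _; rewrite ?invr_gt0//.
  by rewrite !invrK addrC subrK.
by rewrite -!powRrM !divff ?gt_eqF// !powRr1// !invrK mulrC [X in (_ + X)%R]mulrC.
Qed.

(** The integrands agree pointwise: the factor [f1 x] hides the default value at its zeros, and
    where only [f0] vanishes the log-ratio is -oo, whose exponential is 0 = 0 ^ theta because theta
    > 0. *)
Lemma Lambda_likelihood_power (mu : {sigma_finite_measure set S -> \bar R})
    theta : (0 < theta)%R ->
  Lambda mu f0 f1 theta = lne (\int[mu]_x (likelihood_power theta x * f1 x)%:E).
Proof.
move=> t0; congr lne; apply: eq_integral => x _; rewrite EFinM.
have [->|f1x0] := eqVneq (f1 x) 0%R; first by rewrite !mule0.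
congr (_ * _).
have f1x : (0 < f1 x)%R by rewrite lt_neqAle eq_sym f1x0 f1_ge0.
rewrite /log_ratio inver (negbTE f1x0) -EFinM /likelihood_power.
have [->|f0x0] := eqVneq (f0 x) 0%R.
  by rewrite mul0r powR0 ?gt_eqF// mul0r le0_lneNy// gt0_muleNy ?lte_fin.
have f0x : (0 < f0 x)%R by rewrite lt_neqAle eq_sym f0x0 f0_ge0.
rewrite lne_EFin ?divr_gt0//= ln_div ?posrE// /powR (negbTE f0x0) (negbTE f1x0).
by rewrite -expRD mulrBr mulNr.
Qed.

(** Where [f1] is positive the log-ratio may be +oo but not -oo. The first conjunct keeps sums of
    log-ratios free of the form +oo - oo. *)
Lemma expeR_log_ratio theta x : (0 < theta)%R -> (0 < f1 x)%R ->
  -oo < log_ratio f1 f0 x /\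
  expeR (- (theta%:E * log_ratio f1 f0 x)) = (likelihood_power theta x)%:E.
Proof.
move=> t0 f1x; rewrite /log_ratio /likelihood_power.
have [->|f0x0] := eqVneq (f0 x) 0%R.
  rewrite inve0 gt0_muley ?lte_fin//= gt0_muley ?lte_fin//=.
  by rewrite powR0 ?gt_eqF// mul0r.
have f0x : (0 < f0 x)%R by rewrite lt_neqAle eq_sym f0x0 f0_ge0.
rewrite inver (negbTE f0x0) -EFinM lne_EFin ?divr_gt0// ltNyr; split => //.
rewrite /= ln_div ?posrE// /powR (negbTE f0x0) gt_eqF//.
by rewrite -expRD; congr (expR _)%:E; ring.
Qed.

Lemma expeR_sum_log_ratio theta (s : seq nat) (x : nat -> S) :
  (0 < theta)%R -> (forall i, i \in s -> 0 < f1 (x i))%R ->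
  expeR (- (theta%:E * \sum_(i <- s) log_ratio f1 f0 (x i))) =
  (\prod_(i <- s) likelihood_power theta (x i))%:E.
Proof.
move=> t0 sf1.
(* The lower bound is carried through the induction so that multiplication by [theta] and [expeR]
   distribute over the sum. *)
suff : -oo < \sum_(i <- s) log_ratio f1 f0 (x i) /\
    expeR (- (theta%:E * \sum_(i <- s) log_ratio f1 f0 (x i))) =
    (\prod_(i <- s) likelihood_power theta (x i))%:E by case.
elim: s sf1 => [|a s ih] sf1; first by rewrite !big_nil mule0 oppe0 expeR0.
have [lty eqs] := ih (fun i is_ => sf1 i (mem_behead (s := a :: s) is_)).
have [altNy eqa] := expeR_log_ratio t0 (sf1 a (mem_head _ _)).
have ladd : log_ratio f1 f0 (x a) +? \sum_(i <- s) log_ratio f1 f0 (x i).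
  exact: ltninfty_adde_def.
rewrite !big_cons; split.
  by rewrite ltNye adde_eq_ninfty negb_or -!ltNye altNy lty.
by rewrite -mulNe muleDr// expeRD !mulNe eqa eqs EFinM.
Qed.

Lemma measurable_log_ratio : measurable_fun setT (log_ratio f1 f0).
Proof.
have -> : log_ratio f1 f0 = fun x => if f1 x == 0%R then -oo else
    if f0 x == 0%R then +oo else (ln (f1 x) - ln (f0 x))%:E.
  apply/funext => x; rewrite /log_ratio.
  have [->|f1x0] := eqVneq (f1 x) 0%R; first by rewrite mul0e le0_lneNy.
  have f1x : (0 < f1 x)%R by rewrite lt_neqAle eq_sym f1x0 f1_ge0.
  have [->|f0x0] := eqVneq (f0 x) 0%R; first by rewrite inve0 gt0_muley ?lte_fin.
  have f0x : (0 < f0 x)%R by rewrite lt_neqAle eq_sym f0x0 f0_ge0.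
  by rewrite inver (negbTE f0x0) -EFinM lne_EFin ?divr_gt0// ln_div ?posrE.
have mln (f : S -> R) : measurable_fun setT f ->
    measurable_fun setT (fun x => ln (f x)).
  exact: measurableT_comp.
apply: measurable_fun_ifT => //; first exact: measurable_fun_eqr.
apply: measurable_fun_ifT => //; first exact: measurable_fun_eqr.
by apply/measurable_EFinP; apply: measurable_funB; exact: mln.
Qed.

End LikelihoodRatio.

(** * The stopping time and its tail bound *)

Section Detection.
Context {R : realType} {dS dO : measure_display}
        {S : measurableType dS} {Omega : measurableType dO}.
Variables (f0 f1 : S -> R).
Hypotheses (mf0 : measurable_fun setT f0) (mf1 : measurable_fun setT f1).
Hypotheses (f0_ge0 : forall x, (0 <= f0 x)%R) (f1_ge0 : forall x, (0 <= f1 x)%R).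
Variable X : nat -> {mfun Omega >-> S}.

Lemma measurable_cusum n : measurable_fun setT (cusum f0 f1 X n).
Proof.
rewrite /cusum; elim: (index_iota 1 n.+1) => [|k s ih].
  by under eq_fun do rewrite big_nil; exact: measurable_cst.
under eq_fun do rewrite big_cons; apply: measurable_maxe => //.
apply: emeasurable_sum => i.
by apply: measurableT_comp => //; exact: measurable_log_ratio.
Qed.

(** This replaces an infimum, possibly +oo, by finitely many conditions on the CuSum; both
    measurability and the tail bound rest on it. *)
Lemma tau_geP (r deltaF : R) (k : nat) (w : Omega) :
  k%:R%:E <= tau f0 f1 X r deltaF w <->
  forall m, (0 < m < k)%N -> cusum f0 f1 X m w < (threshold r deltaF m)%:E.
Proof.
split=> [ktau m /andP[m0 mk]|H].
  rewrite ltNge; apply/negP => mhit.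
  have : tau f0 f1 X r deltaF w <= m%:R%:E.
    by apply: ereal_inf_lbound; exists m.
  by move=> /(le_trans ktau); rewrite lee_fin ler_nat leqNgt mk.
apply: le_ereal_inf_tmp => _ [m [m0 mhit] <-].
rewrite lee_fin ler_nat leqNgt; apply/negP => mk.
by have := H m; rewrite m0 mk ltNge mhit => /(_ isT).
Qed.

Lemma measurable_tau_ge (r deltaF : R) (k : nat) :
  measurable [set w | k%:R%:E <= tau f0 f1 X r deltaF w].
Proof.
rewrite (_ : [set _ | _] = \bigcap_(m in [set m | (0 < m < k)%N])
    [set w | cusum f0 f1 X m w < (threshold r deltaF m)%:E]); last first.
  by apply/seteqP; split => w /tau_geP.
apply: bigcap_measurableType => m _; rewrite -[X in measurable X]setTI.
by apply: emeasurable_fun_infty_o => //; exact: measurable_cusum.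
Qed.

(** Chernoff's bound on the window of the [d] indices from [nu] to [(nu + d).-1], where every
    observation has density [f1]. *)
Lemma prob_tau_ge (mu : {measure set S -> \bar R}) (P : probability Omega R)
    (r deltaF theta : R) (nu d : nat) :
  mutually_independent P [set i | (nu <= i < nu + d)%N] X ->
  (forall i, (nu <= i < nu + d)%N -> forall A, measurable A ->
     P (X i @^-1` A) = \int[mu]_(x in A) (f1 x)%:E) ->
  \int[mu]_x (likelihood_power f0 f1 theta x * f1 x)%:E \is a fin_num ->
  (0 < nu)%N -> (0 < d)%N -> (0 < theta)%R ->
  P [set w | (nu + d)%:R%:E <= tau f0 f1 X r deltaF w] <=
  (expR (theta * threshold r deltaF (nu + d).-1))%:E *
  (\int[mu]_x (likelihood_power f0 f1 theta x * f1 x)%:E) ^+ d.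
Proof.
move=> indep law Jfin nu0 d0 t0.
set J := \int[mu]_x _ in Jfin *.
set c := threshold _ _ _; pose m := (nu + d).-1.
set g := likelihood_power f0 f1 theta.
have mS : m.+1 = (nu + d)%N by rewrite prednK// addn_gt0 nu0.
pose s := index_iota nu m.+1.
have sE i : i \in s -> (nu <= i < nu + d)%N by rewrite mem_index_iota mS.
have mE := measurable_tau_ge r deltaF (nu + d).
set E := [set w | _] in mE *.
have mU : measurable_fun setT (fun w => \prod_(i <- s) g (X i w))%R.
  apply: measurable_prod => i _; apply: measurableT_comp => //.
  exact: measurable_likelihood_power.
have U0 w : (0 <= \prod_(i <- s) g (X i w))%R.
  by apply: prodr_ge0 => i _; exact: likelihood_power_ge0.
(* The zero set of [f1] has mass zero under the density [f1], so almost surely the window avoids the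
   points where [likelihood_power] takes its default value. *)
have ae_pos : {ae P, forall w, forall i, i \in s -> (0 < f1 (X i w))%R}.
  apply: ae_foralln => i.
  have [is_|nis] := boolP (i \in s); last by apply: aeW.
  have mZ : measurable [set x | f1 x = 0%R].
    rewrite -[X in measurable X]setTI.
    exact: (mf1 measurableT (measurable_set1 0%R)).
  exists (X i @^-1` [set x | f1 x = 0%R]); split.
  - by rewrite -[X in measurable X]setTI; exact: (measurable_funP (X i)).
  - apply: etrans (law i (sE i is_) _ mZ) _.
    by apply: integral0_eq => x /= ->.
  - move=> w /= npos; apply/eqP; rewrite eq_le f1_ge0 andbT leNgt.
    by apply/negP => pos; apply: npos.
have -> : P E = \int[P]_(w in E) 1 by rewrite integral_cst// mul1e.
have <- : \int[P]_w (\prod_(i <- s) g (X i w))%:E = J ^+ d.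
  rewrite (@integral_prod_independent _ _ _ _ _ mu P _ X f1 g _ _ _ _ indep)//.
  - by rewrite size_iota mS addKn.
  - exact: measurable_likelihood_power.
  - exact: likelihood_power_ge0.
  - exact: iota_uniq.
rewrite -ge0_integralZl_EFin ?expR_ge0//; last 2 first.
- by move=> w _; rewrite lee_fin.
- exact/measurable_EFinP.
have mcU : measurable_fun setT
    (fun w => (expR (theta * c))%:E * (\prod_(i <- s) g (X i w))%:E).
  by apply: measurable_funeM; exact/measurable_EFinP.
(* Markov's inequality: the integrand is almost everywhere at least 1 on [E], and enlarging [E] to
   the whole space only increases the integral. *)
apply: (@le_trans _ _ (\int[P]_(w in E)
    ((expR (theta * c))%:E * (\prod_(i <- s) g (X i w))%:E))); last first.
  apply: ge0_subset_integral => //.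
  by move=> w _; rewrite -EFinM lee_fin mulr_ge0 ?expR_ge0.
apply: ae_ge0_le_integral => //.
- by move=> w _; rewrite -EFinM lee_fin mulr_ge0 ?expR_ge0.
- exact: measurable_funTS.
apply: filterS ae_pos => w pos Ew.
rewrite -expeR_sum_log_ratio//.
have /tau_geP/(_ m) := Ew; rewrite -mS ltnS leqnn andbT.
have m0 : (0 < m)%N by rewrite -ltnS mS (leq_add nu0 d0).
have num : (nu <= m)%N by rewrite -ltnS mS -addn1 leq_add2l.
move=> /(_ m0) cus.
(* The maximum defining the CuSum at time [m] includes the sum starting at [nu]. *)
have sumc : \sum_(i <- s) log_ratio f1 f0 (X i w) <= c%:E.
  apply: le_trans (ltW cus).
  apply: (le_bigmax_seq -oo nu predT
    (fun k => \sum_(k <= i < m.+1) log_ratio f1 f0 (X i w))) => //.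
  by rewrite mem_index_iota nu0 ltnS.
rewrite -[(expR _)%:E]/(expeR (theta * c)%:E) -expeRD -expeR0 lee_expeR.
rewrite sube_ge0; first by rewrite EFinM lee_wpmul2l// lee_fin ltW.
by rewrite orbC.
Qed.

End Detection.

(** * Passage to the infimum over theta *)

(* If p exceeded delta then ln p = ln delta + eta with eta > 0, and each
   Chernoff bound would exceed d by the fixed amount kappa, whatever theta:
   so the infimum need not be attained. *)
Lemma le_inf_chernoff (R : realType) (J : R -> \bar R) (p c delta : R) (d : nat) :
  (0 < delta < 1)%R -> (0 <= c)%R ->
  (forall theta, (0 < theta < 1)%R -> 0 <= J theta <= 1 /\
     p%:E <= (expR (theta * c))%:E * J theta ^+ d) ->
  ereal_inf [set (`|lne (J theta)|)^-1 * (ln (1 / delta) + theta * c)%R%:E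
            | theta in [set theta : R | (0 < theta < 1)%R]] <= d%:R%:E ->
  (0 < d)%N -> (p <= delta)%R.
Proof.
move=> /andP[delta0 delta1] c0 H infd d0.
rewrite leNgt; apply/negP => pdelta.
have p0 : (0 < p)%R by exact: lt_trans pdelta.
pose a := (- ln delta)%R.
have a0 : (0 < a)%R by rewrite oppr_gt0 ln_lt0// delta0.
pose eta := (ln p + a)%R.
have eta0 : (0 < eta)%R by rewrite subr_gt0 ltr_ln ?posrE.
have dR0 : (0 < d%:R :> R)%R by rewrite ltr0n.
(* With L = a + theta * c <= a + c, the assumption gives d * (- ln j) <= L - eta, and (L - eta) * (1
   + eta / (a + c)) <= L; hence L / (- ln j) >= d + kappa for every theta. *)
pose kappa := (d%:R * (eta / (a + c)))%R.
have ac0 : (0 < a + c)%R by lra.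
have kappa0 : (0 < kappa)%R by rewrite mulr_gt0// divr_gt0.
suff : (d%:R + kappa)%:E <= d%:R%:E by rewrite lee_fin; lra.
apply: le_trans infd; apply: le_ereal_inf_tmp => _ [theta t01 <-].
have [/andP[J0 J1] pJ] := H _ t01; move: t01 => /andP[t0 t1].
have -> : ln (1 / delta) = a by rewrite div1r lnV ?posrE.
have tc : (0 <= theta * c <= c)%R.
  by rewrite mulr_ge0 ?(ltW t0)//= ler_piMl// ltW.
have L0 : (0 < a + theta * c)%R by lra.
have Jfin : J theta \is a fin_num by rewrite ge0_fin_numE// (le_lt_trans J1) ?ltry.
move: J0 J1 pJ; rewrite -(fineK Jfin); set j := fine _.
rewrite !lee_fin => j0 j1; rewrite -EFin_expe -EFinM lee_fin => pj.
have j_gt0 : (0 < j)%R.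
  rewrite lt_neqAle j0 andbT; apply/eqP => j0'.
  by move: pj; rewrite -j0' expr0n gtn_eqF// mulr0 leNgt p0.
have lnj : (ln p <= theta * c + d%:R * ln j)%R.
  have : (ln p <= ln (expR (theta * c) * j ^+ d))%R.
    by rewrite ler_ln ?posrE ?mulr_gt0 ?expR_gt0 ?exprn_gt0.
  by rewrite lnM ?posrE ?expR_gt0 ?exprn_gt0// expRK lnXn// mulr_natl.
rewrite lne_EFin// abse_EFin ler0_norm ?ln_le0//.
(* If ln j = 0, its inverse is +oo in the extended reals, and so is the bound. *)
have [->|lnj0] := eqVneq (ln j) 0%R.
  by rewrite oppr0 inve0 gt0_mulye ?lte_fin// leey.
have lnj_gt0 : (0 < - ln j)%R by rewrite oppr_gt0 lt_neqAle lnj0 ln_le0.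
rewrite inver gt_eqF// -EFinM lee_fin mulrC ler_pdivlMr//.
have e1 : (d%:R * - ln j <= a + theta * c - eta)%R by rewrite /eta; lra.
have q0 : (0 < eta / (a + c))%R by rewrite divr_gt0.
have -> : ((d%:R + kappa) * - ln j =
          d%:R * - ln j * (1 + eta / (a + c)))%R by rewrite /kappa; ring.
apply: le_trans (ler_wpM2r _ e1) _; first by lra.
have : ((a + theta * c - eta) * (eta / (a + c)) <= eta)%R.
  rewrite mulrCA ler_piMr ?(ltW eta0)// ler_pdivrMr// mul1r; lra.
lra.
Qed.

(** * The latency bound *)

Theorem theorem2 (R : realType) (dS dO : measure_display)
    (S : measurableType dS) (Omega : measurableType dO)
    (mu : {sigma_finite_measure set S -> \bar R})
    (f0 f1 : S -> R)
    (Pr : option nat -> probability Omega R)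
    (X : nat -> {mfun Omega >-> S})
    (hf0 : density mu f0) (hf1 : density mu f1)
    (hf01 : ~ {ae mu, forall x, f0 x = f1 x})
    (hmodel : change_point_model mu f0 f1 Pr X)
    (T : nat) (hT : (0 < T)%N)
    (deltaF deltaD : R)
    (hdeltaF : (0 < deltaF < 1)%R) (hdeltaD : (0 < deltaD < 1)%R)
    (r : R) (hr : (1 < r)%R) :
  latency f0 f1 Pr X r T deltaF deltaD <=
  round_up (ereal_inf
    [set (`|Lambda mu f0 f1 theta|)^-1 *
         (ln (1 / deltaD) + theta * ln (1 / deltaF)
          + r * theta * ln T%:R + theta * ln (zeta r))%R%:E
     | theta in [set theta : R | (0 < theta < 1)%R]]).
Proof.
have [mf0 f0_ge0 intf0] := hf0; have [mf1 f1_ge0 intf1] := hf1.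
have [deltaF0 deltaF1] := andP hdeltaF; have [deltaD0 _] := andP hdeltaD.
have z1 : (1 <= zeta r)%R by exact: zeta_ge1.
have z0 : (0 < zeta r)%R by exact: lt_le_trans z1.
have thresholdE n : (0 < n)%N ->
    threshold r deltaF n = (ln (zeta r) + r * ln n%:R - ln deltaF)%R.
  move=> n0; rewrite /threshold ln_div ?posrE ?mulr_gt0 ?powR_gt0 ?ltr0n//.
  by rewrite lnM ?posrE ?powR_gt0 ?ltr0n// ln_powR.
(* [round_up] is itself an infimum over positive integers, so it suffices that each such [d] is
   admissible in the definition of [latency]. *)
apply: le_ereal_inf_tmp => _ [d [d0 infd] <-].
apply: ereal_inf_lbound; exists d => //; split=> // nu /andP[nu0 nuTd].
set E := [set w | _].
pose J theta := \int[mu]_x (likelihood_power f0 f1 theta x * f1 x)%:E.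
have J01 theta : (0 < theta < 1)%R -> 0 <= J theta <= 1.
  move=> t01; have /andP[t0 t1] := t01; apply/andP; split.
    by apply: integral_ge0 => x _; rewrite lee_fin mulr_ge0 ?likelihood_power_ge0.
  (* By weighted AM-GM, the integrand of [J] lies below a convex combination of two densities, whose
     integral is 1. *)
  have -> : 1%E = \int[mu]_x (theta * f0 x + (1 - theta) * f1 x)%:E.
    under eq_integral do rewrite EFinD !EFinM.
    rewrite ge0_integralD//=.
    - rewrite !ge0_integralZl_EFin ?intf0 ?intf1//; last 6 first.
      + by move=> x _; rewrite lee_fin.
      + exact/measurable_EFinP.
      + lra.
      + by move=> x _; rewrite lee_fin.
      + exact/measurable_EFinP.
      + exact: ltW.
      by rewrite !mule1 -EFinD addrC subrK.
    - by move=> x _; rewrite -EFinM lee_fin mulr_ge0// ltW.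
    - by apply: measurable_funeM; exact/measurable_EFinP.
    - by move=> x _; rewrite -EFinM lee_fin mulr_ge0//; lra.
    - by apply: measurable_funeM; exact/measurable_EFinP.
  apply: ge0_le_integral => //.
  - by move=> x _; rewrite lee_fin mulr_ge0 ?likelihood_power_ge0.
  - apply/measurable_EFinP; apply: measurable_funM => //.
    exact: measurable_likelihood_power.
  - by apply/measurable_EFinP; apply: measurable_funD; exact: measurable_funM.
  - by move=> x _; rewrite lee_fin likelihood_power_le.
rewrite -[Pr _ E]fineK ?fin_num_measure//; last exact: measurable_tau_ge.
rewrite lee_fin.
have T0 : (0 <= threshold r deltaF T)%R.
  rewrite thresholdE//; have := ln_ge0 z1; have := ln_le0 (ltW deltaF1).
  have : (0 <= r * ln T%:R)%R by rewrite mulr_ge0 ?ln_ge0 ?ler1n//; lra.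
  lra.
apply: (le_inf_chernoff (J := J) hdeltaD T0 _ _ d0); last first.
  (* The three terms carrying theta in the stated bound add up to theta times the threshold at
     [T]. *)
  apply: le_trans infd; rewrite le_eqVlt; apply/orP; left; apply/eqP.
  congr ereal_inf; apply: eq_imagel => theta /= /andP[t0 _].
  rewrite Lambda_likelihood_power//; congr (_ * _%:E).
  by rewrite thresholdE// [ln (1 / deltaF)]ln_div ?posrE// ln1; ring.
move=> theta t01; split; first exact: J01.
have /andP[t0 t1] := t01; have /andP[J0 J1] := J01 _ t01.
have Jfin : J theta \is a fin_num.
  by rewrite ge0_fin_numE// (le_lt_trans J1) ?ltry.
have [indep law] := hmodel (Some nu) nu0.
rewrite fineK ?fin_num_measure//; last exact: measurable_tau_ge.
have tail : Pr (Some nu) E <=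
    (expR (theta * threshold r deltaF (nu + d).-1))%:E * J theta ^+ d.
  apply: prob_tau_ge.
  - exact: mf0.
  - exact: mf1.
  - exact: f0_ge0.
  - exact: f1_ge0.
  - move=> I A uI sI; apply: indep => // i /sI /= /andP[nui _].
    exact: leq_trans nui.
  - move=> i /andP[nui _] A mA.
    apply: etrans (law i (leq_trans nu0 nui) A mA) _.
    by rewrite /before_change ltnNge nui.
  - exact: Jfin.
  - exact: nu0.
  - exact: d0.
  - exact: t0.
apply: (le_trans tail).
have Tmono : (threshold r deltaF (nu + d).-1 <= threshold r deltaF T)%R.
  have m0 : (0 < (nu + d).-1)%N by rewrite -subn1 subn_gt0 (leq_add nu0 d0).
  rewrite (thresholdE _ m0) (thresholdE _ hT) lerD2r lerD2l.
  apply: ler_wpM2l; first by lra.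
  rewrite ler_ln ?posrE ?ltr0n// ler_nat; apply: leq_trans (leq_pred _) _.
  (* As nu >= 1, the truncated difference [T - d] is positive, so nu <= T - d really means nu + d <=
     T. *)
  have dT : (d < T)%N by rewrite -subn_gt0 (leq_trans nu0).
  by rewrite addnC -leq_subRL// ltnW.
have tT : (expR (theta * threshold r deltaF (nu + d).-1))%:E <=
    (expR (theta * threshold r deltaF T))%:E.
  by rewrite lee_fin ler_expR; apply: ler_wpM2l => //; exact: ltW.
exact: (lee_wpmul2r (expe_ge0 _ J0) tT).
Qed.
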